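(* Let $n\ge 1$ and $m\ge 1$ be relatively prime integers with $m\le n$. Then for any prime $p$ and any integer $\alpha\ge 1$, $$\binom{np^{\alpha}}{mp^{\alpha}}\equiv\binom{n}{m}\pmod{np}.$$ *)

(* Defs.v *)
From mathcomp Require Export all_boot.

(* Main.v *)
(** Multiplying by [m] turns both binomials into multiples of [n]:
    [m * 'C(n * q, m * q) = n * 'C(n * q - 1, m * q - 1)], with [q = p ^ alpha]
    or [q = 1].  By Lucas the two cofactors of [n] agree modulo [p], so
    [m * 'C(n * q, m * q)] and [m * 'C(n, m)] agree modulo [n * p].  If [p] does
    not divide [m], then [m] can be cancelled.  Otherwise [p] is coprime to
    [n]; the two binomials agree modulo [p] by Lucas, and modulo [n] both
    vanish since [m] is coprime to [n]. *)
Require Import Defs.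
From mathcomp Require Import all_boot.

Lemma eqn_modMl_coprime (d k a b : nat) : coprime d k ->
  (k * a == k * b %[mod d]) = (a == b %[mod d]).
Proof.
move=> cdk; wlog le_ba: a b / b <= a.
  by move=> W; case: (leqP b a) => [/W //|/ltnW/W E]; rewrite eq_sym E eq_sym.
by rewrite !eqn_mod_dvd ?leq_mul2l ?le_ba ?orbT // -mulnBr Gauss_dvdr.
Qed.

(** In Vandermonde's sum every term after the first has a factor ['C(p, i)] with [0 < i < p], a
    multiple of [p]. *)
Lemma bin_addp_small (p N k : nat) : prime p -> k < p ->
  'C(p + N, k) = 'C(N, k) %[mod p].
Proof.
move=> pp kp; rewrite -binomial.Vandermonde big_ord_recl bin0 mul1n subn0.
rewrite -modnDmr [X in _ + X](_ : _ = 0) ?addn0 //.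
apply/eqP/dvdn_sum => i _; apply/dvdn_mulr/prime_dvd_bin => //=.
exact: leq_ltn_trans (ltn_ord i) kp.
Qed.

(** Here two Vandermonde terms survive, those taking none or all of the [p] elements. *)
Lemma bin_addp_large (p N k : nat) : prime p ->
  'C(p + N, p + k) = 'C(N, p + k) + 'C(N, k) %[mod p].
Proof.
move=> pp; have p0 := prime_gt0 pp.
rewrite -binomial.Vandermonde big_ord_recl bin0 mul1n subn0.
have lt_p : p.-1 < p + k by rewrite prednK // leq_addr.
(* Splitting off the first term shifted the indices by one, so the term with ['C(p, p)] sits at
   [p.-1]. *)
rewrite (bigD1 (Ordinal lt_p)) //= /bump /= add1n prednK // binn mul1n addKn.
rewrite addnA -modnDmr [X in _ + X](_ : _ = 0) ?addn0 //.
apply/eqP/dvdn_sum => i /eqP neq_i; rewrite /bump /= add1n.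
have [lt_i|gt_i|eq_i] := ltngtP i.+1 p.
- exact/dvdn_mulr/prime_dvd_bin.
- by rewrite bin_small.
- by case: neq_i; apply/val_inj/(congr1 predn eq_i).
Qed.

(** Modulo [p], adding [p] to both arguments imitates Pascal's rule for [n] and [m], whence the
    induction. *)
Lemma lucas_same_digit (p n m r : nat) : prime p -> r < p ->
  'C(n * p + r, m * p + r) = 'C(n, m) %[mod p].
Proof.
move=> pp rp; elim: n m => [|n IHn] [|m].
- by rewrite !mul0n binn.
- by rewrite bin_small // ltn_add2r mulSn ltn_addr ?prime_gt0.
- rewrite mulSn mul0n -addnA bin_addp_small // !bin0.
  by have:= IHn 0; rewrite mul0n bin0.
- have IHm1 := IHn m.+1; rewrite mulSn -addnA in IHm1.
  by rewrite binS !mulSn -!addnA bin_addp_large // -modnDm IHm1 IHn modnDm.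
Qed.

Lemma bin_mul_expp (p n m a : nat) : prime p ->
  'C(n * p ^ a, m * p ^ a) = 'C(n, m) %[mod p].
Proof.
move=> pp; elim: a => [|a IHa]; first by rewrite !muln1.
have := lucas_same_digit p (n * p ^ a) (m * p ^ a) 0 pp (prime_gt0 pp).
by rewrite !addn0 -!mulnA -!expnSr IHa.
Qed.

Lemma bin_mul_expp_pred (p n m a : nat) : prime p -> 0 < n -> 0 < m ->
  'C((n * p ^ a).-1, (m * p ^ a).-1) = 'C(n.-1, m.-1) %[mod p].
Proof.
move=> pp n0 m0; have p0 := prime_gt0 pp.
elim: a => [|a IHa]; first by rewrite !muln1.
(* Both arguments end in the base-[p] digit [p.-1], which serves as [r] in [lucas_same_digit]. *)
have predMp k : 0 < k -> (k * p).-1 = k.-1 * p + p.-1.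
  by case: k => // k _; rewrite mulSn addnC -subn1 -addnBA // subn1.
have pos k : 0 < k -> 0 < k * p ^ a by move=> k0; rewrite muln_gt0 k0 expn_gt0 p0.
by rewrite expnSr !mulnA !predMp ?pos // lucas_same_digit ?prednK.
Qed.

Lemma mul_bin_scale (n m q : nat) : 0 < n -> 0 < m -> 0 < q ->
  m * 'C(n * q, m * q) = n * 'C((n * q).-1, (m * q).-1).
Proof.
(* Scaled by [q], this is the absorption identity [mul_bin_diag]. *)
move=> n0 m0 q0; apply/eqP; rewrite -(eqn_pmul2l q0) !mulnA ![q * _]mulnC.
by rewrite mul_bin_diag prednK // muln_gt0 m0.
Qed.

Lemma dvdn_bin_scale (n m q : nat) : 0 < n -> 0 < m -> 0 < q -> coprime n m ->
  n %| 'C(n * q, m * q).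
Proof.
by move=> n0 m0 q0 cnm; rewrite -(Gauss_dvdr _ cnm) mul_bin_scale // dvdn_mulr.
Qed.

Theorem corollary3 (n m : nat) (hn : 1 <= n) (hm : 1 <= m)
    (hcop : coprime n m) (hmn : m <= n)
    (p : nat) (hp : prime p) (alpha : nat) (halpha : 1 <= alpha) :
  'C(n * p ^ alpha, m * p ^ alpha) = 'C(n, m) %[mod n * p].
Proof.
have q0 : 0 < p ^ alpha by rewrite expn_gt0 prime_gt0.
apply/eqP; have [pm|npm] := boolP (p %| m).
  have cnp : coprime n p by exact: coprime_dvdr hcop.
  rewrite chinese_remainder // bin_mul_expp // eqxx andbT.
  have := dvdn_bin_scale n m 1 hn hm isT hcop; rewrite !muln1 => /eqP ->.
  exact: dvdn_bin_scale.
rewrite -(@eqn_modMl_coprime _ m); last by rewrite coprimeMl hcop prime_coprime.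
have := mul_bin_scale n m 1 hn hm isT; rewrite !muln1 => ->.
by rewrite mul_bin_scale // -!muln_modr bin_mul_expp_pred.
Qed.
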